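(* For every $\epsilon\in[0,\infty)$, in the subgame $\Gamma(z^{\pi_1}(\epsilon),\epsilon)$ starting at time $\epsilon$ on the cooperative trajectory $z^{\pi_1}$, the sustainably-cooperative optimality principle is a subset of the imputation set: $$Z(z^{\pi_1}(\epsilon),\epsilon)\subset R(z^{\pi_1}(\epsilon),\epsilon).$$
   Context: Three players $N=\{1,2,3\}$ (1 and 2 ''farsighted'', 3 ''myopic''). Constants: $a_i,b_i,\xi_i>0$ for $i\in N$; $q_1,q_2>0$, $q_3=0$, $q:=q_1+q_2$; $\rho>0$, $T>0$, $\tau\in(0,1)$, $\delta_1,\delta_2>0$, $z_0>0$. The function $\delta$ is $T$-periodic: for $k\in\mathbb N_0$, $\delta(t)=\delta_1$ for $t\in[kT,(k+\tau)T)$ and $\delta(t)=\delta_2$ for $t\in[(k+\tau)T,(k+1)T)$. An (open-loop) control of player $i$ is a measurable function $v_i$ with values in $[0,b_i]$; given $v=(v_1,v_2,v_3)$ the state satisfies $\dot z=\sum_{i=1}^3\xi_iv_i(t)-\delta(t)z$. Subgame $\Gamma(y,\epsilon)$: it starts at time $\epsilon$ with $z(\epsilon)=y$, and player $i$'s payoff is $$K_i(y,\epsilon;v)=\int_\epsilon^\infty e^{-\rho(t-\epsilon)}\big[a_iv_i(t)(b_i-v_i(t)/2)-q_iz(t)\big]\,dt,$$ where $z$ is the state driven by $v$ from $z(\epsilon)=y$. Put $s_1=\delta_1+\rho$, $s_2=\delta_2+\rho$, $$m_1=\frac{(s_2-s_1)(1-e^{s_2T(\tau-1)})}{s_1s_2(e^{s_1\tau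 T}-e^{s_2T(\tau-1)})},\qquad m_2=e^{-s_2T}\Big(m_1-\frac1{s_1}+\frac1{s_2}\Big),$$ and for $k\in\mathbb N_0$ $$L(t)=\begin{cases}m_1e^{s_1(t-kT)}-\frac1{s_1},&t\in[kT,(k+\tau)T],\\ m_2e^{s_2(t-kT)}-\frac1{s_2},&t\in[(k+\tau)T,(k+1)T].\end{cases}$$ ($L$ is the $T$-periodic solution of $\dot L=1+(\rho+\delta(t))L$.) Coalition structures: $\pi_1=\{\{1,2,3\}\}$, $\pi_3=\{\{1,2\},\{3\}\}$, $\pi_{41}=\{\{1,3\},\{2\}\}$, $\pi_{42}=\{\{2,3\},\{1\}\}$. The associated strategy profiles $v^\pi=(v_1^\pi,v_2^\pi,v_3^\pi)$ are $$v_i^{\pi}(t)=b_i+\frac{\xi_i}{a_i}\,c_i^{\pi}L(t),$$ with $(c_1^{\pi},c_2^{\pi},c_3^{\pi})$ equal to $(q,q,q)$ for $\pi_1$; $(q,q,0)$ for $\pi_3$; $(q_1,q_2,q_1)$ for $\pi_{41}$; $(q_1,q_2,q_2)$ for $\pi_{42}$. Standing assumption (environmental sustainability): $c_i^\pi L(t)\in[-a_ib_i/\xi_i,0]$ for all $t>0$, all $i$ and all these $\pi$. The cooperative trajectory $z^{\pi_1}(t)$, $t\ge0$, is the state driven by $v^{\pi_1}$ from $z^{\pi_1}(0)=z_0$. Write $K_i^\pi(\epsilon):=K_i(z^{\pi_1}(\epsilon),\epsilon;v^\pi)$: the payoff of player $i$ when the subgame starts at time $\epsilon$ from $z^{\pi_1}(\epsilon)$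 and the profile $v^\pi$ is used from then on. Characteristic function (von Neumann–Morgenstern) of the subgame $\Gamma(z^{\pi_1}(\epsilon),\epsilon)$: $V(\emptyset)=0$; for nonempty $S\subsetneq N$, $V(S)=\max_{v_i,\,i\in S}\ \min_{v_j,\,j\in N\setminus S}\ \sum_{i\in S}K_i(z^{\pi_1}(\epsilon),\epsilon;v)$; and $V(N)=\max_{v}\sum_{i=1}^3K_i(z^{\pi_1}(\epsilon),\epsilon;v)$, which equals $\sum_{i=1}^3K_i^{\pi_1}(\epsilon)$. Imputation set: $$R(z^{\pi_1}(\epsilon),\epsilon)=\Big\{\eta\in\mathbb R^3:\ \sum_{i=1}^3\eta_i=V(N),\ \eta_i\ge V(\{i\}),\ i\in N\Big\}.$$ Sustainably-cooperative optimality principle: $$Z(z^{\pi_1}(\epsilon),\epsilon)=\Big\{\zeta\in\mathbb R^3:\ \sum_{i=1}^3\zeta_i=V(N),\ \zeta_1\ge K_1^{\pi_{42}}(\epsilon),\ \zeta_2\ge K_2^{\pi_{41}}(\epsilon),\ \zeta_3\ge K_3^{\pi_3}(\epsilon)\Big\}.$$ The symbol $\subset$ denotes (not necessarily strict) inclusion. *)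

(* Defs.v *)
From HB Require Import structures.
From mathcomp Require Import all_boot all_order all_algebra.
From mathcomp Require Import all_classical all_reals all_analysis.

Set Implicit Arguments.
Unset Strict Implicit.
Unset Printing Implicit Defensive.

Import Order.TTheory GRing.Theory Num.Theory.
Import numFieldNormedType.Exports.

Local Open Scope classical_set_scope.
Local Open Scope ring_scope.

Definition player1 : 'I_3 := @Ordinal 3 0 isT.
Definition player2 : 'I_3 := @Ordinal 3 1 isT.
Definition player3 : 'I_3 := @Ordinal 3 2 isT.

Record game (R : realType) := Game {
  a : 'I_3 -> R;
  b : 'I_3 -> R;
  xi : 'I_3 -> R;
  q : 'I_3 -> R;
  rho : R;
  T : R;
  tau : R;
  delta1 : R;
  delta2 : R;
  z0 : R;
  a_gt0 : forall i, 0 < a i;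
  b_gt0 : forall i, 0 < b i;
  xi_gt0 : forall i, 0 < xi i;
  q1_gt0 : 0 < q player1;
  q2_gt0 : 0 < q player2;
  q3_eq0 : q player3 = 0;
  rho_gt0 : 0 < rho;
  T_gt0 : 0 < T;
  tau_gt0 : 0 < tau;
  tau_lt1 : tau < 1;
  delta1_gt0 : 0 < delta1;
  delta2_gt0 : 0 < delta2;
  z0_gt0 : 0 < z0
}.

(* [{1,2,3}], [{1,2},{3}], [{1,3},{2}] and [{2,3},{1}] respectively. *)
Inductive coalition_structure := pi1 | pi3 | pi41 | pi42.

Section Extrema.
Variable R : realType.
Implicit Type A : set R.

(* Attained extrema: the default 0 is returned when A has no greatest (resp.
   least) element, even if its supremum (resp. infimum) exists. *)
Definition maximum A : R := xget 0 (A `&` ubound A).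
Definition minimum A : R := xget 0 (A `&` lbound A).

End Extrema.

Section Game.
Variables (R : realType) (G : game R).
Implicit Types (i : 'I_3) (y eps t : R) (z : R -> R) (v u w : 'I_3 -> R -> R).
Implicit Types (S : {set 'I_3}) (pi : coalition_structure).

Local Notation mu := (@lebesgue_measure R).

(* t - kT for the k such that kT <= t < (k+1)T *)
Definition phase t : R := t - (Num.floor (t / T G))%:~R * T G.

Definition delta t : R :=
  if phase t < tau G * T G then delta1 G else delta2 G.

Definition admissible eps v : Prop :=
  forall i, measurable_fun `[eps, +oo[ (v i) /\
            forall t, eps <= t -> 0 <= v i t <= b G i.

Definition velocity v z t : R := \sum_(i < 3) xi G i * v i t - delta t * z t.

(* Caratheodory solution on [eps, +oo[ of the state equation: controls are only
   measurable, so the equation is required in integral form. *)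
Definition is_state y eps v z : Prop :=
  forall t, eps <= t ->
    mu.-integrable `[eps, t] (EFin \o velocity v z) /\
    z t = y + \int[mu]_(s in `[eps, t]) velocity v z s.

(* The state is unique on [eps, +oo[; its values before eps are irrelevant. *)
Definition state y eps v : R -> R := xget (fun=> 0) [set z | is_state y eps v z].

Definition payoff i y eps v : R :=
  \int[mu]_(t in `[eps, +oo[)
    (expR (- rho G * (t - eps)) *
     (a G i * v i t * (b G i - v i t / 2) - q G i * state y eps v t)).

Definition s1 : R := delta1 G + rho G.
Definition s2 : R := delta2 G + rho G.

Definition m1 : R :=
  ((s2 - s1) * (1 - expR (s2 * T G * (tau G - 1)))) /
  (s1 * s2 * (expR (s1 * tau G * T G) - expR (s2 * T G * (tau G - 1)))).

Definition m2 : R := expR (- s2 * T G) * (m1 - s1^-1 + s2^-1).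

(* The two branches agree at phase tau * T, and L has the same value at both
   ends of a period, so this is the piecewise formula on closed pieces. *)
Definition L t : R :=
  if phase t <= tau G * T G then m1 * expR (s1 * phase t) - s1^-1
  else m2 * expR (s2 * phase t) - s2^-1.

Definition cost_weight pi i : R :=
  let q1 := q G player1 in
  let q2 := q G player2 in
  nth 0 (match pi with
         | pi1 => [:: q1 + q2; q1 + q2; q1 + q2]
         | pi3 => [:: q1 + q2; q1 + q2; 0]
         | pi41 => [:: q1; q2; q1]
         | pi42 => [:: q1; q2; q2]
         end) i.

Definition profile pi i t : R :=
  b G i + xi G i / a G i * cost_weight pi i * L t.

Definition sustainable : Prop :=
  forall pi i t, 0 < t ->
    - (a G i * b G i / xi G i) <= cost_weight pi i * L t <= 0.

Definition coop_traj : R -> R := state (z0 G) 0 (profile pi1).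

Definition struct_payoff pi i eps : R :=
  payoff i (coop_traj eps) eps (profile pi).

Definition coalition_payoff S y eps v : R := \sum_(i in S) payoff i y eps v.

(* S plays according to u and its complement according to w. *)
Definition join_profile S u w : 'I_3 -> R -> R :=
  fun i => if i \in S then u i else w i.

Definition charfun y eps S : R :=
  if S == finset.set0 then 0
  else if S == [set: 'I_3]%SET then
    maximum [set coalition_payoff S y eps v | v in admissible eps]
  else
    maximum [set minimum [set coalition_payoff S y eps (join_profile S u w)
                         | w in admissible eps]
            | u in admissible eps].

Definition V eps S : R := charfun (coop_traj eps) eps S.

Definition imputations eps : set 'rV[R]_3 :=
  [set eta : 'rV[R]_3 |
    \sum_(i < 3) eta ord0 i = V eps [set: 'I_3]%SET /\
    forall i, V eps [set i]%SET <= eta ord0 i].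

Definition sustainably_cooperative eps : set 'rV[R]_3 :=
  [set zeta : 'rV[R]_3 |
    [/\ \sum_(i < 3) zeta ord0 i = V eps [set: 'I_3]%SET,
        struct_payoff pi42 player1 eps <= zeta ord0 player1,
        struct_payoff pi41 player2 eps <= zeta ord0 player2 &
        struct_payoff pi3 player3 eps <= zeta ord0 player3]].

End Game.

(* Main.v *)
(* Let L be the periodic solution of L' = 1 + (rho + delta) L.  For every
   control v with inflow f = sum_j xi_j v_j and state z, the product rule gives
     (e^{-rho (t - eps)} L z)' = e^{-rho (t - eps)} (z + L f),
   so the discounted integral of z is - L(eps) y - int e^{-rho (t - eps)} L f,
   and up to a constant independent of v the payoff of player i becomes
     int e^{-rho (t - eps)} (a_i v_i (b_i - v_i / 2) + q_i L f) dt.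
   All extrema can then be computed pointwise.  Since L <= 0, the opponents of i
   minimise the integrand with v_j = b_j, and i maximises it with
   v_i = b_i + xi_i q_i L / a_i, which is the component of i in each profile
   whose cost weight for i is q_i.  Replacing the opponents' b_j by the
   smaller controls of that profile can only increase the payoff of i.
   As the controls are merely measurable, derivatives are understood in integral
   form; the product rule is Fubini's theorem on a triangle. *)
Require Import Defs.
From mathcomp Require Import all_boot all_order all_algebra.
From mathcomp Require Import all_classical all_reals all_analysis.
From mathcomp Require Import measurable_realfun ring lra.
Import Order.TTheory GRing.Theory Num.Theory.
Import numFieldNormedType.Exports.
Local Open Scope classical_set_scope.
Local Open Scope ring_scope.

(** * Indefinite Lebesgue integrals *)

Section Primitive.
Set Implicit Arguments.
Unset Strict Implicit.
Context {R : realType}.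
Local Notation mu := (@lebesgue_measure R).
Implicit Types (f g F G : R -> R) (a b c t : R).

(** Both sides integrate f(s) g(r) over the triangle a <= r <= s <= b. Extending f and g by zero and
    multiplying by the indicator [chi] of r <= s puts the integrand on the whole plane, where Fubini
    applies. *)
Lemma Rintegral_triangle f g a b :
  mu.-integrable `[a, b] (EFin \o f) -> mu.-integrable `[a, b] (EFin \o g) ->
  \int[mu]_(s in `[a, b]) (f s * \int[mu]_(r in `[a, s]) g r) =
  \int[mu]_(r in `[a, b]) (g r * \int[mu]_(s in `[r, b]) f s).
Proof.
move=> intf intg.
set D := `[a, b]%classic.
have mD : measurable (D : set (measurableTypeR R)) by exact: measurable_itv.
pose f' : R -> R := f \_ D; pose g' : R -> R := g \_ D.
have intf' : mu.-integrable setT (EFin \o f').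
  by have := iffLR (integrable_mkcond _ mD) intf; rewrite restrict_EFin.
have intg' : mu.-integrable setT (EFin \o g').
  by have := iffLR (integrable_mkcond _ mD) intg; rewrite restrict_EFin.
have mf' : measurable_fun setT f' by apply/measurable_EFinP; exact: measurable_int intf'.
have mg' : measurable_fun setT g' by apply/measurable_EFinP; exact: measurable_int intg'.
pose chi (p : measurableTypeR R * measurableTypeR R) : R := if p.2 <= p.1 then 1 else 0.
have mchi : measurable_fun setT chi.
  rewrite /chi; apply: measurable_fun_ifT => //.
  by apply: measurable_fun_ler; [exact: measurable_snd|exact: measurable_fst].
pose h p := f' p.1 * g' p.2 * chi p.
have mh : measurable_fun setT (EFin \o h).
  apply/measurable_EFinP; apply: measurable_funM => //.
  by apply: measurable_funM; apply: measurableT_comp.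
(* Since [chi] is at most 1, |h| is dominated by |f'(x)| |g'(y)|, whose iterated integral is a
   product of two finite integrals. *)
have inth : (mu \x mu)%E.-integrable setT (EFin \o h).
  apply/integrable12ltyP => //=.
  apply: (@le_lt_trans _ _ (\int[mu]_x (`|f' x|%:E * \int[mu]_y `|g' y|%:E))%E).
    apply: ge0_le_integral => //=.
    - by move=> x _; apply: integral_ge0.
    - apply: (@measurable_fun_fubini_tonelli_F _ _ _ _ _ mu (fun p => `|h p|%:E)) => //=.
      by apply/measurable_EFinP; apply: measurableT_comp => //; exact/measurable_EFinP.
    - by apply: emeasurable_funM => //; apply/measurable_EFinP/measurableT_comp.
    - move=> x _; rewrite -ge0_integralZl//=.
      + apply: ge0_le_integral => //=.
        * apply/measurable_EFinP; apply: measurableT_comp => //.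
          by apply: (measurableT_comp (f := h)) => //; exact/measurable_EFinP.
        * by apply: measurable_funeM; apply/measurable_EFinP; apply: measurableT_comp.
        * move=> y _; rewrite -EFinM lee_fin /h /chi !normrM ler_piMr//.
          by rewrite (fun_if Num.norm) normr1 normr0; case: ifP.
      + by apply/measurable_EFinP; apply: measurableT_comp.
  have /integrableP[_ fi] := intf'; have /integrableP[_ gi] := intg'.
  rewrite ge0_integralZr//=.
  - apply: lte_mul_pinfty => //; first exact: integral_ge0.
    by rewrite ge0_fin_numE//; exact: integral_ge0.
  - by apply/measurable_EFinP; apply: measurableT_comp.
  - exact: integral_ge0.
have := Fubini inth.
have -> : (\int[mu]_x \int[mu]_y (EFin \o h) (x, y) =
   \int[mu]_(x in D) (f x * \int[mu]_(r in `[a, x]) g r)%:E)%E.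
  rewrite [RHS]integral_mkcond; apply: eq_integral => x _.
  rewrite patchE; case: ifPn => xD; last first.
    by rewrite integral0_eq// => y _; rewrite /= /h /f' patchE (negbTE xD) !mul0r.
  move: xD; rewrite inE /D /= in_itv/= => /andP[ax xb].
  have gax : mu.-integrable `[a, x] (EFin \o g).
    by apply: integrableS intg => //; apply: subset_itvl; rewrite bnd_simp.
  rewrite EFinM fineK; last exact: integrable_fin_num.
  rewrite -integralZl//= [RHS]integral_mkcond; apply: eq_integral => y _.
  rewrite /h /f' /g' /chi/= !patchE.
  rewrite (mem_set (_ : D x)); last by rewrite /D/= in_itv/= ax.
  rewrite /D /=.
  rewrite !mem_setE !in_itv/=; case: (leP a y) => ay /=; last by rewrite mulr0 mul0r.
  case: (leP y x) => yx; last by rewrite mulr0.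
  by rewrite (le_trans yx xb) mulr1.
have -> : (\int[mu]_y \int[mu]_x (EFin \o h) (x, y) =
   \int[mu]_(r in D) (g r * \int[mu]_(s in `[r, b]) f s)%:E)%E.
  rewrite [RHS]integral_mkcond; apply: eq_integral => y _.
  rewrite patchE; case: ifPn => yD; last first.
    by rewrite integral0_eq// => x _; rewrite /= /h /g' patchE (negbTE yD) mulr0 mul0r.
  move: yD; rewrite inE /D /= in_itv/= => /andP[ay yb].
  have fyb : mu.-integrable `[y, b] (EFin \o f).
    by apply: integrableS intf => //; apply: subset_itvr; rewrite bnd_simp.
  rewrite EFinM fineK; last exact: integrable_fin_num.
  rewrite -integralZl//= [RHS]integral_mkcond; apply: eq_integral => x _.
  rewrite /h /f' /g' /chi/= !patchE.
  rewrite (mem_set (_ : D y)); last by rewrite /D/= in_itv/= ay.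
  rewrite /D /=.
  rewrite !mem_setE !in_itv/=; case: (leP y x) => yx /=; last by rewrite mulr0.
  by rewrite (le_trans ay yx)/=; case: (_ <= b); rewrite mulr1 ?mul0r// mulrC.
by move=> e; rewrite /Rintegral; congr fine.
Qed.

(** Integral form of F' = f, seen only through the end points a and b; [primitive_from] requires it
    on every [a, t], which is the Caratheodory sense of the equation. *)
Definition increment a b f F :=
  mu.-integrable `[a, b] (EFin \o f) /\ F b = F a + \int[mu]_(s in `[a, b]) f s.

Definition primitive_from a f F := forall t, a <= t -> increment a t f F.

Lemma Rintegral_itvD f a b c : a <= c -> c <= b ->
  mu.-integrable `[a, b] (EFin \o f) ->
  \int[mu]_(s in `[a, b]) f s =
  \int[mu]_(s in `[a, c]) f s + \int[mu]_(s in `[c, b]) f s.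
Proof.
move=> ac cb intf.
have intf' : mu.-integrable `]c, b] (EFin \o f).
  by apply: integrableS intf => //; apply: subset_itv; rewrite bnd_simp.
rewrite -(Rintegral_itv_obnd_cbnd intf') -(Rintegral_itvB intf) ?bnd_simp//.
by rewrite addrC subrK.
Qed.

Lemma integrable_setU f (A B : set R) : measurable A -> measurable B ->
  [disjoint A & B] ->
  mu.-integrable A (EFin \o f) -> mu.-integrable B (EFin \o f) ->
  mu.-integrable (A `|` B) (EFin \o f).
Proof.
move=> mA mB AB /integrableP[mfA ifA] /integrableP[mfB ifB].
apply/integrableP.
have mf : measurable_fun (A `|` B) (EFin \o f) by apply/measurable_funU.
split => //; rewrite ge0_integral_setU//=.
- by apply: lte_add_pinfty.
- by apply/measurable_EFinP; apply: measurableT_comp => //; exact/measurable_EFinP.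
Qed.

Lemma integrable_itvU f a b c : a <= c -> c <= b ->
  mu.-integrable `[a, c] (EFin \o f) -> mu.-integrable `[c, b] (EFin \o f) ->
  mu.-integrable `[a, b] (EFin \o f).
Proof.
move=> ac cb iac icb.
have {}icb : mu.-integrable `]c, b] (EFin \o f).
  by apply: integrableS icb => //; apply: subset_itv; rewrite bnd_simp.
have -> : `[a, b]%classic = `[a, c] `|` `]c, b].
  rewrite predeqE => x; split; rewrite /= !in_itv/=.
    by move=> /andP[ax xb]; case: (leP x c) => xc; [left; rewrite ax|right].
  move=> [/andP[-> xc]|/andP[cx ->]]; first by rewrite (le_trans xc).
  by rewrite (le_trans ac)// ltW.
apply: integrable_setU => //.
apply/disj_setPS => x; rewrite /= !in_itv/= => -[/andP[_ xc] /andP[cx _]].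
by move: (lt_le_trans cx xc); rewrite ltxx.
Qed.

Lemma integrable_itv_bndo_bndc f a b :
  mu.-integrable `[a, b[ (EFin \o f) -> mu.-integrable `[a, b] (EFin \o f).
Proof.
case: (leP a b) => [ab i|ba _]; last first.
  by rewrite set_itv_ge ?bnd_simp -?ltNge//; exact: integrable_set0.
rewrite -(@setUitv1 _ _ _ _ true) ?bnd_simp//; apply: integrable_setU => //.
- apply/disj_setPS => x [] /=; rewrite in_itv/= => /andP[_ xb] xE.
  by rewrite xE ltxx in xb.
- apply/integrableP; split; first exact: measurable_fun_set1.
  by rewrite integral_set1.
Qed.

(** The formula for f is required on [a, b[ only, because the intended derivatives involve [delta],
    which may jump at b. *)
Lemma increment_expR (m0 m r x0 : R) f F a b : a <= b ->
  (forall t, a <= t <= b -> F t = m0 + m * expR (r * (t - x0))) ->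
  (forall t, a <= t < b -> f t = m * r * expR (r * (t - x0))) ->
  increment a b f F.
Proof.
rewrite le_eqVlt => /predU1P[<- _ _|ab FE fE].
  split; last by rewrite set_itv1 Rintegral_set1 addr0.
  apply: integrable_itv_bndo_bndc; rewrite set_itv_ge ?bnd_simp ?ltxx//.
  exact: integrable_set0.
(* [f1] and [F1] extend the formulas smoothly to the whole line, so the fundamental theorem applies
   to them; f differs from [f1] on [a, b] at most at the null point b. *)
pose f1 t := m * r * expR (r * (t - x0)).
pose F1 t := m0 + m * expR (r * (t - x0)).
have dF t : is_derive t 1 F1 (f1 t).
  have d1 : is_derive t 1 (fun t => r * (t - x0)) r.
    by apply: is_derive_eq; rewrite subr0 -[X in X = _]/(r * 1) mulr1.
  have := is_derive1_comp (is_derive_expR _) d1 => d2.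
  by apply: is_derive_eq; rewrite add0r /f1 /GRing.scale /=; ring.
have cf1 : continuous f1.
  move=> t; have d1 : is_derive t 1 (fun t => r * (t - x0)) r.
    by apply: is_derive_eq; rewrite subr0 -[X in X = _]/(r * 1) mulr1.
  have := is_derive1_comp (is_derive_expR _) d1 => d2.
  apply: differentiable_continuous; apply/derivable1_diffP.
  by apply: derivableM => //; exact: derivable_cst.
have cF1 : continuous F1.
  by move=> t; apply: differentiable_continuous; apply/derivable1_diffP.
have i1 : mu.-integrable `[a, b] (EFin \o f1).
  apply: continuous_compact_integrable; first exact: segment_compact.
  exact: continuous_subspaceT.
have i2 : mu.-integrable `[a, b[ (EFin \o f1).
  by apply: integrableS i1 => //; apply: subset_itvl; rewrite bnd_simp.
have i3 : mu.-integrable `[a, b[ (EFin \o f).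
  by apply: eq_integrable i2 => //= x; rewrite inE/= in_itv/= => xab; rewrite fE.
split; first exact: integrable_itv_bndo_bndc.
rewrite -(Rintegral_itv_bndo_bndc i3).
transitivity (F a + \int[mu]_(s in `[a, b[) f1 s); last first.
  congr (_ + _); apply: eq_Rintegral => x.
  by rewrite inE/= in_itv/= => xab; rewrite fE.
rewrite (Rintegral_itv_bndo_bndc i2) /Rintegral (@continuous_FTC2 _ f1 F1)//=.
- by rewrite !FE ?lexx ?(ltW ab)// /F1/= ; ring.
- exact: continuous_subspaceT.
- split => //; first by apply: cvg_at_right_filter; exact: cF1.
  by apply: cvg_at_left_filter; exact: cF1.
- by move=> x _; rewrite derive1E; apply: derive_val.
Qed.

Lemma increment_cat f F a b c : a <= c -> c <= b ->
  increment a c f F -> increment c b f F -> increment a b f F.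
Proof.
move=> ac cb [i1 e1] [i2 e2].
have i := integrable_itvU ac cb i1 i2.
by split=> //; rewrite (Rintegral_itvD ac cb)// addrA -e1.
Qed.

Lemma increment_right f F a b c : a <= c -> c <= b ->
  increment a c f F -> increment a b f F -> increment c b f F.
Proof.
move=> ac cb [_ e1] [i2 e2]; split.
  by apply: integrableS i2 => //; apply: subset_itv; rewrite bnd_simp.
by move: e2; rewrite (Rintegral_itvD ac cb)// addrA -e1.
Qed.

Lemma primitive_from_ge f F a c : a <= c ->
  primitive_from a f F -> primitive_from c f F.
Proof.
move=> ac p t ct; apply: (increment_right ac) => //; apply: p => //.
exact: le_trans ct.
Qed.

Lemma eq_primitive_from f g F G a : (forall t, a <= t -> f t = g t) ->
  (forall t, a <= t -> F t = G t) -> primitive_from a f F ->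
  primitive_from a g G.
Proof.
move=> fg FG p t at_; have [i e] := p _ at_; split.
  apply: eq_integrable i => //= x; rewrite inE/= in_itv/= => /andP[ax _].
  by rewrite fg.
rewrite -!FG// e; congr (_ + _); apply: eq_Rintegral => x.
by rewrite inE/= in_itv/= => /andP[ax _]; rewrite fg.
Qed.

(** On [a, b], F is a constant plus an indefinite integral, hence continuous. *)
Lemma primitive_from_measurable_itv f F a b :
  primitive_from a f F -> measurable_fun `[a, b] F.
Proof.
move=> p; case: (leP a b) => [ab|ba]; last first.
  by rewrite set_itv_ge ?bnd_simp -?ltNge//; exact: measurable_fun_set0.
have [i _] := p _ ab.
have /= c := parameterized_integral_continuous ab i.
apply: (@eq_measurable_fun _ _ _ _ _ (fun x => F a + \int[mu]_(s in `[a, x]) f s)).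
  by move=> x; rewrite inE/= in_itv/= => /andP[ax _]; have [_ <-] := p _ ax.
apply: measurable_funD => //.
by apply: subspace_continuous_measurable_fun => //.
Qed.

Lemma primitive_from_measurable f F a :
  primitive_from a f F -> measurable_fun `[a, +oo[ F.
Proof.
move=> p.
have -> : `[a, +oo[%classic = \bigcup_n `[a, a + n%:R]%classic.
  rewrite predeqE => x; split; rewrite /= in_itv/= ?andbT.
    move=> ax; exists (Num.truncn (x - a)).+1 => //=; rewrite in_itv/= ax/=.
    by rewrite -lerBlDl ltW// truncnS_gt.
  by move=> [n _]/=; rewrite in_itv/= => /andP[].
apply/measurable_fun_bigcup => // n; exact: primitive_from_measurable_itv p.
Qed.

Lemma primitive_from_bounded f F a b :
  primitive_from a f F -> [bounded F x | x in `[a, b]].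
Proof.
move=> p; case: (leP a b) => [ab|ba]; last first.
  rewrite set_itv_ge ?bnd_simp -?ltNge//.
  by exists 0; split => // M _ x.
have [i _] := p _ ab.
exists (`|F a| + \int[mu]_(s in `[a, b]) `|f s|); split; first by rewrite num_real.
move=> M /ltW lM x /=; rewrite in_itv/= => /andP[ax xb]; apply: le_trans lM.
have [ix ->] := p _ ax; apply: le_trans (ler_normD _ _) _; rewrite lerD2l.
apply: le_trans (le_normr_Rintegral _ ix) _ => //.
have i' : mu.-integrable `[a, b] (EFin \o (fun s => `|f s|)) by exact: integrable_norm.
rewrite (Rintegral_itvD ax xb)// lerDl; exact: Rintegral_ge0.
Qed.

Lemma primitive_from_integrableM f F g a b : primitive_from a f F ->
  mu.-integrable `[a, b] (EFin \o g) ->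
  mu.-integrable `[a, b] (EFin \o (fun t => F t * g t)).
Proof.
move=> p i.
have mF := @primitive_from_measurable_itv _ _ _ b p.
have bF := @primitive_from_bounded _ _ _ b p.
have := @integrableMr _ _ R mu `[a, b]%classic (measurable_itv _) F _ mF bF i.
by apply: eq_integrable.
Qed.

(** Product rule without pointwise derivatives: the initial values split off linearly, and the
    remaining double integral is handled by [Rintegral_triangle]. *)
Lemma primitive_fromM f g F G a : primitive_from a f F -> primitive_from a g G ->
  primitive_from a (fun t => f t * G t + F t * g t) (fun t => F t * G t).
Proof.
move=> pF pG t at_.
have [iF eF] := pF _ at_; have [iG eG] := pG _ at_.
have i1 : mu.-integrable `[a, t] (EFin \o (fun s => f s * G s)).
  apply: eq_integrable (primitive_from_integrableM pG iF) => //= x _.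
  by rewrite mulrC.
have i2 := primitive_from_integrableM pF iG.
split; first by apply: eq_integrable (integrableD _ i1 i2).
rewrite RintegralD//.
(* [P] and [Q] are F - F(a) and G - G(a). *)
pose P s := \int[mu]_(r in `[a, s]) f r.
pose Q s := \int[mu]_(r in `[a, s]) g r.
have pP : primitive_from a f P.
  move=> s as_; have [? _] := pF _ as_; split=> //.
  by rewrite /P set_itv1 Rintegral_set1 add0r.
have pQ : primitive_from a g Q.
  move=> s as_; have [? _] := pG _ as_; split=> //.
  by rewrite /Q set_itv1 Rintegral_set1 add0r.
have -> : \int[mu]_(s in `[a, t]) (f s * G s) =
    G a * P t + \int[mu]_(s in `[a, t]) (f s * Q s).
  rewrite /P -RintegralZl// -RintegralD//.
  - apply: eq_Rintegral => s; rewrite inE/= in_itv/= => /andP[as_ _].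
    by have [_ ->] := pG _ as_; rewrite mulrDr mulrC.
  - by apply: eq_integrable (integrableZl _ (G a) iF).
  - by apply: eq_integrable (primitive_from_integrableM pQ iF) => //= x _; rewrite mulrC.
have iPg : mu.-integrable `[a, t] (EFin \o (fun s => g s * P s)).
  by apply: eq_integrable (primitive_from_integrableM pP iG) => //= x _; rewrite mulrC.
have -> : \int[mu]_(s in `[a, t]) (F s * g s) =
    F a * Q t + \int[mu]_(s in `[a, t]) (g s * P s).
  rewrite /Q -RintegralZl// -RintegralD//.
  - apply: eq_Rintegral => s; rewrite inE/= in_itv/= => /andP[as_ _].
    by have [_ ->] := pF _ as_; rewrite mulrDl [g s * _]mulrC.
  - by apply: eq_integrable (integrableZl _ (F a) iG).
(* Exchanging the order leaves the inner integral of f over [s, t], that is P(t) - P(s). The P(s)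
   part then cancels against the integral of g P, leaving P(t) Q(t). *)
have -> : \int[mu]_(s in `[a, t]) (f s * Q s) =
    \int[mu]_(s in `[a, t]) (P t * g s - g s * P s).
  rewrite Rintegral_triangle//; apply: eq_Rintegral => s.
  rewrite inE/= in_itv/= => /andP[as_ st].
  by rewrite /P (Rintegral_itvD as_ st iF); ring.
rewrite RintegralB//; last by apply: eq_integrable (integrableZl _ (P t) iG).
rewrite RintegralZl// eF eG -/(P t) -/(Q t); ring.
Qed.

End Primitive.

(** * The periodic coefficients *)

Section Periodic.
Context {R : realType}.
Set Implicit Arguments.
Unset Strict Implicit.
Local Notation mu := (@lebesgue_measure R).
Variable G : game R.
Implicit Types (f F : R -> R) (t : R) (k : nat).

Lemma phaseE k t : k%:R * T G <= t < k.+1%:R * T G -> phase G t = t - k%:R * T G.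
Proof.
move=> /andP[kt tk]; have T0 := T_gt0 G; rewrite /phase.
rewrite (@floor_def _ _ (k%:Z))//.
rewrite ler_pdivlMr// kt/= ltr_pdivrMr//.
by rewrite -PoszD addn1.
Qed.

Lemma tauT_gt0 : 0 < tau G * T G.
Proof. by rewrite mulr_gt0 ?tau_gt0 ?T_gt0. Qed.

Lemma tauT_lt : tau G * T G < T G.
Proof. by rewrite gtr_pMl ?tau_lt1 ?T_gt0. Qed.

Lemma delta_left k t : k%:R * T G <= t < k%:R * T G + tau G * T G ->
  delta G t = delta1 G.
Proof.
move=> /andP[kt tk]; have := tauT_lt => tT.
rewrite /delta (@phaseE k); last by rewrite kt -natr1 mulrDl mul1r (lt_trans tk)// ltrD2l.
by rewrite ltrBlDl tk.
Qed.

Lemma delta_right k t : k%:R * T G + tau G * T G <= t < k.+1%:R * T G ->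
  delta G t = delta2 G.
Proof.
move=> /andP[kt tk]; have := tauT_gt0 => tT.
rewrite /delta (@phaseE k); last by rewrite tk andbT (le_trans _ kt)// lerDl ltW.
by rewrite ltrBlDl ltNge kt.
Qed.

Lemma measurable_phase : measurable_fun setT (phase G).
Proof.
apply: measurable_funB => //; apply: measurable_funM => //.
apply: nondecreasing_measurable => // x y xy.
by rewrite ler_int le_floor// ler_pM2r// invr_gt0 T_gt0.
Qed.

Lemma measurable_delta : measurable_fun setT (delta G).
Proof.
apply: measurable_fun_ifT => //; apply: measurable_fun_ltr => //.
exact: measurable_phase.
Qed.

Lemma delta_gt0 t : 0 < delta G t.
Proof. by rewrite /delta; case: ifP; rewrite ?delta1_gt0 ?delta2_gt0. Qed.

Lemma delta_bounds t :
  Num.min (delta1 G) (delta2 G) <= delta G t <= Num.max (delta1 G) (delta2 G).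
Proof. by rewrite /delta; case: ifP => _; rewrite ge_min le_max !lexx ?orbT. Qed.

(** Increments concatenate, so it is enough to treat the two pieces of each period separately; on
    each of them [delta] is constant up to the right end point. *)
Lemma primitive_from_periodic f F :
  (forall k t, k%:R * T G <= t <= k%:R * T G + tau G * T G ->
     increment (k%:R * T G) t f F) ->
  (forall k t, k%:R * T G + tau G * T G <= t <= k.+1%:R * T G ->
     increment (k%:R * T G + tau G * T G) t f F) ->
  primitive_from 0 f F.
Proof.
move=> inc1 inc2; have T0 := T_gt0 G; have := tauT_gt0; have := tauT_lt => tT tT0.
have step k t : k%:R * T G <= t <= k.+1%:R * T G -> increment (k%:R * T G) t f F.
  move=> /andP[kt tk]; case: (leP t (k%:R * T G + tau G * T G)) => h.
    by apply: inc1; rewrite kt.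
  apply: increment_cat (inc1 k _ _) (inc2 k _ _).
  - by rewrite lerDl ltW.
  - exact: ltW.
  - by rewrite lexx lerDl ltW.
  - by rewrite tk ltW.
have base k : increment 0 (k%:R * T G) f F.
  elim: k => [|k IH].
    by have := @step 0%N 0; rewrite mul0r lexx mul1r => /(_ (ltW T0)).
  apply: increment_cat IH (step k _ _).
  - by rewrite mulr_ge0// ltW.
  - by rewrite ler_pM2r// ler_nat.
  - by rewrite lexx ler_pM2r// ler_nat leqnSn.
(* k counts the complete periods before t: [base] covers them and [step] covers the rest. *)
move=> t t0; pose k := Num.truncn (t / T G).
have kt : k%:R * T G <= t.
  by rewrite -ler_pdivlMr// truncn_le// divr_ge0// ltW.
apply: increment_cat (base k) (step k _ _) => //.
  by rewrite mulr_ge0// ltW.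
by rewrite kt/= -ler_pdivrMr// ltW// truncnS_gt.
Qed.

(* [expR \o decay] is the integrating factor of the state equation. *)
Definition decay t : R := \int[mu]_(s in `[0, t]) delta G s.

Lemma integrable_delta a b : mu.-integrable `[a, b] (EFin \o delta G).
Proof.
apply: measurable_bounded_integrable => //.
- by rewrite /= lebesgue_measure_itv; case: ifP; rewrite ?ltry.
- by apply: measurable_funTS; exact: measurable_delta.
- exists (Num.max (delta1 G) (delta2 G)); split; first by rewrite num_real.
  move=> M hM t _; rewrite /= ger0_norm ?(ltW (delta_gt0 _))// ltW//.
  by apply: le_lt_trans hM; have /andP[] := delta_bounds t.
Qed.

Lemma decay_primitive : primitive_from 0 (delta G) decay.
Proof.
move=> t t0; split; first exact: integrable_delta.
by rewrite /decay set_itv1 Rintegral_set1 add0r.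
Qed.

Lemma decay_cst a b d : 0 <= a <= b -> {in `[a, b[, forall t, delta G t = d} ->
  decay b = decay a + d * (b - a).
Proof.
move=> /andP[a0 ab] h.
have [_ ->] := primitive_from_ge a0 decay_primitive ab; congr (_ + _).
have i : mu.-integrable `[a, b[ (EFin \o delta G).
  apply: integrableS (integrable_delta a b) => //.
  by apply: subset_itvl; rewrite bnd_simp.
rewrite -(Rintegral_itv_bndo_bndc i).
transitivity (\int[mu]_(s in `[a, b[) d).
  by apply: eq_Rintegral => t; rewrite inE/= => /h.
rewrite Rintegral_cst//= lebesgue_measure_itv/= lte_fin; case: ifPn => //.
by rewrite -leNgt => ba; rewrite (le_anti (_ : a <= b <= a)) ?subrr ?ab ?ba.
Qed.

Lemma le_decay a b : 0 <= a -> a <= b -> decay a <= decay b.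
Proof.
move=> a0 ab; have [_ ->] := primitive_from_ge a0 decay_primitive ab.
by rewrite lerDl; apply: Rintegral_ge0 => t _; exact/ltW/delta_gt0.
Qed.

(** On each piece [decay] is affine, so the function is an exponential covered by
    [increment_expR]. *)
Lemma expR_decay_primitive (c : R) :
  primitive_from 0 (fun t => c * delta G t * expR (c * decay t))
    (fun t => expR (c * decay t)).
Proof.
have T0 := T_gt0 G; have := tauT_gt0; have := tauT_lt => tT tT0.
have piece a b d : 0 <= a -> {in `[a, b[, forall t, delta G t = d} ->
   forall t, a <= t <= b -> increment a t (fun t => c * delta G t * expR (c * decay t))
    (fun t => expR (c * decay t)).
  move=> a0 h t /andP[at_ tb].
  have E s : a <= s <= t -> decay s = decay a + d * (s - a).
    move=> /andP[as_ st]; apply: decay_cst; first by rewrite a0.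
    move=> x; rewrite in_itv/= => /andP[ax xs]; apply: h; rewrite in_itv/= ax/=.
    by rewrite (lt_le_trans xs)// (le_trans st).
  apply: (@increment_expR _ 0 (expR (c * decay a)) (c * d) a) => //.
    by move=> s /E ->; rewrite add0r -expRD; congr expR; ring.
  move=> s /andP[as_ st]; rewrite E ?as_ 1?ltW// h; last first.
    by rewrite in_itv/= as_/= (lt_le_trans st).
  by rewrite mulrDr expRD [c * (d * (s - a))]mulrA; ring.
apply: primitive_from_periodic => k t kt.
  apply: piece kt; first by rewrite mulr_ge0// ltW.
  by move=> x; rewrite in_itv/=; exact: delta_left.
apply: piece kt; first by rewrite addr_ge0 ?mulr_ge0// ltW// tau_gt0.
by move=> x; rewrite in_itv/=; exact: delta_right.
Qed.

(** The cases c = 1 and c = -1 of the previous lemma; E' denotes the reciprocal of E, not its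
    derivative. *)
Lemma integrating_factor : exists E E' : R -> R,
  [/\ forall t, 0 < E t, forall t, E' t * E t = 1,
      forall s t, 0 <= s -> s <= t -> E s <= E t,
      primitive_from 0 (fun t => delta G t * E t) E &
      primitive_from 0 (fun t => - delta G t * E' t) E'].
Proof.
exists (fun t => expR (1 * decay t)), (fun t => expR (- 1 * decay t)); split.
- by move=> t; exact: expR_gt0.
- by move=> t; rewrite -expRD mul1r mulN1r addNr expR0.
- by move=> s t s0 st; rewrite ler_expR !mul1r le_decay.
- by apply: eq_primitive_from (expR_decay_primitive 1) => t _; rewrite ?mul1r.
- by apply: eq_primitive_from (expR_decay_primitive (- 1)) => t _; rewrite ?mulN1r.
Qed.

Lemma s1_gt0 : 0 < s1 G.
Proof. by rewrite addr_gt0 ?delta1_gt0 ?rho_gt0. Qed.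

Lemma s2_gt0 : 0 < s2 G.
Proof. by rewrite addr_gt0 ?delta2_gt0 ?rho_gt0. Qed.

(** Continuity of L at the switching time. After substitution of [m2] this is a linear equation for
    [m1], and the definition of [m1] is its solution. *)
Lemma L_junction : m1 G * expR (s1 G * (tau G * T G)) - (s1 G)^-1 =
  m2 G * expR (s2 G * (tau G * T G)) - (s2 G)^-1.
Proof.
have := s1_gt0; have := s2_gt0 => s20 s10.
have s1n := lt0r_neq0 s10; have s2n := lt0r_neq0 s20.
have -> : m2 G * expR (s2 G * (tau G * T G)) =
    expR (s2 G * T G * (tau G - 1)) * (m1 G - (s1 G)^-1 + (s2 G)^-1).
  rewrite /m2 mulrAC -expRD; congr (expR _ * _); ring.
rewrite /m1 -[s1 G * tau G * T G]mulrA.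
set e1 := expR (s1 G * (tau G * T G)); set e2 := expR (s2 G * T G * (tau G - 1)).
(* The exponents have opposite signs, so e2 < 1 < e1. *)
have den : e1 - e2 != 0.
  apply: lt0r_neq0; rewrite subr_gt0 (@lt_trans _ _ 1)//.
    by rewrite expR_lt1// nmulr_llt0 ?mulr_gt0 ?T_gt0// subr_lt0 tau_lt1.
  by rewrite expR_gt1 mulr_gt0// tauT_gt0.
by field; rewrite s1n s2n den.
Qed.

(** Equality of L at both ends of a period; this is the equation that defines [m2]. *)
Lemma L_period : m1 G - (s1 G)^-1 = m2 G * expR (s2 G * T G) - (s2 G)^-1.
Proof.
by rewrite /m2 [expR _ * _]mulrC -mulrA -expRD mulNr addNr expR0 mulr1 addrK.
Qed.

Lemma L_left k t : k%:R * T G <= t <= k%:R * T G + tau G * T G ->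
  L G t = m1 G * expR (s1 G * (t - k%:R * T G)) - (s1 G)^-1.
Proof.
move=> /andP[kt tk]; have := tauT_lt => tT.
rewrite /L (@phaseE k); last by rewrite kt -natr1 mulrDl mul1r (le_lt_trans tk)// ltrD2l.
by rewrite lerBlDl tk.
Qed.

(** At both end points [L] is computed by its first branch: at the left one because the test is
    [<=], at the right one because the phase restarts at 0. [L_junction] and [L_period] reconcile
    the values. *)
Lemma L_right k t : k%:R * T G + tau G * T G <= t <= k.+1%:R * T G ->
  L G t = m2 G * expR (s2 G * (t - k%:R * T G)) - (s2 G)^-1.
Proof.
have T0 := T_gt0 G; have := tauT_gt0 => tT0.
rewrite le_eqVlt => /andP[/predU1P[<- _|kt]].
  rewrite (@L_left k) ?lexx ?andbT ?lerDl ?ltW//.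
  by rewrite [k%:R * T G + _]addrC addrK L_junction.
rewrite le_eqVlt => /predU1P[->|tk].
  rewrite (@L_left k.+1) ?lexx/= ?lerDl ?ltW//.
  rewrite subrr mulr0 expR0 mulr1 L_period -natr1.
  by congr (_ * expR (_ * _) - _); ring.
rewrite /L (@phaseE k); last by rewrite tk andbT ltW// (lt_trans _ kt)// ltrDl.
by rewrite lerBlDl leNgt kt.
Qed.

(** On a piece with rate s = rho + delta, L + 1/s is a multiple of an exponential of rate s, so L' =
    s (L + 1/s) = 1 + s L. *)
Lemma L_primitive :
  primitive_from 0 (fun t => 1 + (rho G + delta G t) * L G t) (L G).
Proof.
have s1n := lt0r_neq0 s1_gt0; have s2n := lt0r_neq0 s2_gt0.
apply: primitive_from_periodic => k t /andP[kt tk].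
  apply: (@increment_expR _ (- (s1 G)^-1) (m1 G) (s1 G) (k%:R * T G)) => //
    s /andP[ks st].
    by rewrite (@L_left k) ?ks ?(le_trans st)// addrC.
  rewrite (@L_left k) ?ks/= ?(ltW (lt_le_trans st _))//.
  rewrite (@delta_left k) ?ks ?(lt_le_trans st)//.
  by rewrite [rho G + _]addrC -/(s1 G); field.
apply: (@increment_expR _ (- (s2 G)^-1) (m2 G) (s2 G) (k%:R * T G)) => //
  s /andP[ks st].
  by rewrite (@L_right k) ?ks ?(le_trans st)// addrC.
rewrite (@L_right k) ?ks/= ?(ltW (lt_le_trans st _))//.
rewrite (@delta_right k) ?ks ?(lt_le_trans st)//.
by rewrite [rho G + _]addrC -/(s2 G); field.
Qed.

(** * Sign and boundedness of L under the standing assumption *)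

Section Sustainable.
Hypothesis Gsust : sustainable G.

(** The assumption speaks of t > 0 only; time 0 is reached through L(0) = L(T). *)
Lemma sustainable_ge0 pi i t : 0 <= t ->
  - (a G i * b G i / xi G i) <= cost_weight G pi i * L G t <= 0.
Proof.
rewrite le_eqVlt => /predU1P[<-|]; last exact: Gsust.
have T0 := T_gt0 G; suff -> : L G 0 = L G (T G) by exact: Gsust.
rewrite (@L_left 0 0) ?(@L_right 0 (T G)) ?mul0r ?mul1r ?add0r ?lexx ?subr0 ?mulr0.
- by rewrite oppr0 mulr0 expR0 mulr1 L_period.
- by rewrite andbT ltW// tauT_lt.
- by rewrite ltW// tauT_gt0.
Qed.

(** Player 1 has weight q_1 > 0 under [pi41], which can be divided out of the upper bound;
    [L_bounded] does the same with the lower one. *)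
Lemma L_le0 t : 0 <= t -> L G t <= 0.
Proof.
move=> t0; have /andP[_] := sustainable_ge0 pi41 player1 t0.
by rewrite /cost_weight/= pmulr_rle0// q1_gt0.
Qed.

Lemma L_bounded : exists2 B : R, 0 <= B & forall t, 0 <= t -> `|L G t| <= B.
Proof.
exists (a G player1 * b G player1 / xi G player1 / q G player1).
  by rewrite !divr_ge0 ?mulr_ge0 ?ltW ?a_gt0 ?b_gt0 ?xi_gt0 ?q1_gt0.
move=> t t0; rewrite ler0_norm ?L_le0//.
have /andP[+ _] := sustainable_ge0 pi41 player1 t0.
by rewrite /cost_weight/= ler_pdivlMr ?q1_gt0// mulNr lerNl mulrC.
Qed.

End Sustainable.

End Periodic.

(** * Integrals over half-lines *)

Section Improper.
Context {R : realType}.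
Set Implicit Arguments.
Unset Strict Implicit.
Local Notation mu := (@lebesgue_measure R).
Implicit Types (f F : R -> R) (a l : R).

(** Dominated convergence for the restrictions of f to [a, a + n], with |f| as the dominating
    function. *)
Lemma cvg_Rintegral_itvy f a : mu.-integrable `[a, +oo[ (EFin \o f) ->
  \int[mu]_(s in `[a, a + n%:R]) f s @[n --> \oo] --> \int[mu]_(s in `[a, +oo[) f s.
Proof.
move=> i.
pose f_ n : R -> \bar R := (EFin \o f) \_ `[a, a + n%:R].
have mf : measurable_fun `[a, +oo[ (EFin \o f) by exact: measurable_int i.
have sub n : `[a, a + n%:R]%classic `<=` `[a, +oo[ by exact: subset_itvl.
have mf_ n : measurable_fun `[a, +oo[ (f_ n).
  apply/measurable_restrict => //; rewrite setIidr//.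
  exact: measurable_funS mf.
have := @dominated_convergence _ _ _ mu _ (measurable_itv `[a, +oo[) f_
  (EFin \o f) (abse \o (EFin \o f)) mf_ mf.
case.
- apply: aeW => x /=; rewrite in_itv/= andbT => ax.
  apply: cvg_near_cst; near=> n.
  rewrite /f_ patchE mem_set//= in_itv/= ax/= -lerBlDl.
  near: n; exact: nbhs_infty_ger.
- exact: integrable_abse.
- apply: aeW => x n _; rewrite /f_ patchE; case: ifPn => //= _.
  by rewrite normr0 lee_fin.
move=> _ _ c; apply: fine_cvg.
rewrite -[X in _ --> X]/(_) fineK; last exact: integrable_fin_num i.
apply: cvg_trans c; apply: near_eq_cvg; near=> n.
rewrite /= -[in RHS](setIidr (sub n)) integral_mkcondr; exact: eq_integral.
Unshelve. all: by end_near. Qed.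

Lemma Rintegral_primitive_from f F a l : mu.-integrable `[a, +oo[ (EFin \o f) ->
  primitive_from a f F -> F t @[t --> +oo] --> l ->
  \int[mu]_(s in `[a, +oo[) f s = l - F a.
Proof.
move=> i p Fl; have c := cvg_Rintegral_itvy i.
apply: (cvg_unique _ c) => //.
have -> : (fun n : nat => \int[mu]_(s in `[a, a + n%:R]) f s) =
    (fun n : nat => F (a + n%:R) - F a).
  apply/funext => n; have [|_ ->] := p (a + n%:R); rewrite ?lerDl//.
  by rewrite [F a + _]addrC addrK.
apply: cvgB; last exact: cvg_cst.
apply: (cvg_comp (fun n : nat => a + n%:R) F _ Fl).
apply/cvgryPge => A; near=> n; rewrite -lerBlDl; near: n; exact: nbhs_infty_ger.
Unshelve. all: by end_near. Qed.

End Improper.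

(** * State and payoffs *)

Section State.
Context {R : realType}.
Set Implicit Arguments.
Unset Strict Implicit.
Local Notation mu := (@lebesgue_measure R).
Variables (G : game R) (eps : R).
Hypothesis eps_ge0 : 0 <= eps.
Implicit Types (v : 'I_3 -> R -> R) (y t : R) (z g : R -> R).

Definition inflow v t : R := \sum_(i < 3) xi G i * v i t.

Definition inflow_max : R := \sum_(i < 3) xi G i * b G i.

Lemma inflow_bounds v t : admissible G eps v -> eps <= t ->
  0 <= inflow v t <= inflow_max.
Proof.
move=> adm et; apply/andP; split.
  apply: sumr_ge0 => i _; have [_ /(_ t et)/andP[v0 _]] := adm i.
  by rewrite mulr_ge0// ltW// xi_gt0.
apply: ler_sum => i _; have [_ /(_ t et)/andP[_ vb]] := adm i.
by rewrite ler_pM2l// xi_gt0.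
Qed.

Lemma measurable_inflow v : admissible G eps v ->
  measurable_fun `[eps, +oo[ (inflow v).
Proof.
move=> adm; apply: measurable_sum => i; apply: measurable_funM => //.
by have [] := adm i.
Qed.

Lemma inflow_max_ge0 : 0 <= inflow_max.
Proof. by apply: sumr_ge0 => i _; rewrite mulr_ge0// ltW// ?xi_gt0 ?b_gt0. Qed.

Lemma integrable_inflow v t : admissible G eps v ->
  mu.-integrable `[eps, t] (EFin \o inflow v).
Proof.
move=> adm; apply: measurable_bounded_integrable => //.
- by rewrite /= lebesgue_measure_itv; case: ifP; rewrite ?ltry.
- by apply: measurable_funS (measurable_inflow adm) => //; exact: subset_itvl.
- exists inflow_max; split; first by rewrite num_real.
  move=> M /ltW hM s /=; rewrite in_itv/= => /andP[es _].
  have /andP[f0 fM] := inflow_bounds adm es.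
  by rewrite ger0_norm// (le_trans fM).
Qed.

(** The initial condition is the integral equation at t = eps, where the integral runs over a single
    point. *)
Lemma is_stateP y v z : is_state G y eps v z <->
  primitive_from eps (velocity G v z) z /\ z eps = y.
Proof.
split => [st|[p zy] t et]; last by have [] := p t et; rewrite zy.
have zy : z eps = y.
  by have [_ ->] := st eps (lexx _); rewrite set_itv1 Rintegral_set1 addr0.
by split=> // t et; have [] := st t et; rewrite /increment zy.
Qed.

(** Variation of constants: with the integrating factor E, the solution is z = E^{-1} W, where
    W(eps) = E(eps) y and W' = E f for the inflow f. *)
Lemma is_state_exists y v : admissible G eps v -> exists z, is_state G y eps v z.
Proof.
move=> adm.
have [E [E' [_ EE' _ pE pE']]] := integrating_factor G.
have {}pE := primitive_from_ge eps_ge0 pE.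
have {}pE' := primitive_from_ge eps_ge0 pE'.
pose W t := E eps * y + \int[mu]_(s in `[eps, t]) (E s * inflow v s).
have pW : primitive_from eps (fun t => E t * inflow v t) W.
  move=> t et; split.
    exact: primitive_from_integrableM pE (integrable_inflow t adm).
  by rewrite /W set_itv1 Rintegral_set1 addr0.
exists (fun t => E' t * W t); apply/is_stateP; split; last first.
  by rewrite /W set_itv1 Rintegral_set1 addr0 mulrA EE' mul1r.
apply: eq_primitive_from (primitive_fromM pE' pW) => //= t et.
by rewrite mulrA EE' mul1r /velocity -/(inflow v t); ring.
Qed.

Lemma state_is_state y v : admissible G eps v ->
  is_state G y eps v (state G y eps v).
Proof. by move=> adm; apply: (xgetPex (fun=> 0)); exact: is_state_exists. Qed.

(** The equation reads (E z)' = E f. With d the smaller decay rate, f is at most ([inflow_max] / d)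
    delta, and delta E integrates to the increment of E; division by E(t) gives a bound uniform in
    t. *)
Lemma state_bounded y v z : admissible G eps v -> is_state G y eps v z ->
  exists2 B : R, 0 <= B & forall t, eps <= t -> `|z t| <= B.
Proof.
move=> adm /is_stateP[pz zy].
pose d := Num.min (delta1 G) (delta2 G).
have d0 : 0 < d by rewrite lt_min delta1_gt0 delta2_gt0.
have M0 := inflow_max_ge0.
exists (`|y| + inflow_max / d); first by rewrite addr_ge0// divr_ge0// ltW.
move=> t et.
have [E [_ [E0 _ leE pE _]]] := integrating_factor G.
have {}pE := primitive_from_ge eps_ge0 pE.
have pEz : primitive_from eps (fun t => E t * inflow v t) (fun t => E t * z t).
  apply: eq_primitive_from (primitive_fromM pE pz) => // s _.
  by rewrite /velocity -/(inflow v s); ring.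
have [iEf eq1] := pEz _ et; have [iE eq2] := pE _ et.
have EE := leE _ _ eps_ge0 et.
have h0 : 0 <= \int[mu]_(s in `[eps, t]) (E s * inflow v s).
  apply: Rintegral_ge0 => s /=; rewrite in_itv/= => /andP[es _].
  have /andP[f0 _] := inflow_bounds adm es.
  exact: mulr_ge0 (ltW (E0 s)) f0.
have h1 : \int[mu]_(s in `[eps, t]) (E s * inflow v s) <= inflow_max / d * (E t - E eps).
  rewrite eq2 [E eps + _]addrC addrK -RintegralZl//.
  apply: le_Rintegral => //.
    by apply: eq_integrable (integrableZl _ (inflow_max / d) iE).
  move=> s /=; rewrite in_itv/= => /andP[es _].
  have /andP[f0 fM] := inflow_bounds adm es.
  rewrite mulrA mulrC ler_wpM2r ?(ltW (E0 _))// (le_trans fM)//.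
  rewrite mulrAC ler_pdivlMr// ler_wpM2l//.
  by have /andP[] := delta_bounds G s.
have : E t * `|z t| <= E t * (`|y| + inflow_max / d).
  rewrite -{1}(gtr0_norm (E0 t)) -normrM eq1 zy.
  apply: le_trans (ler_normD _ _) _; rewrite mulrDr lerD//.
    by rewrite normrM gtr0_norm// ler_wpM2r.
  rewrite ger0_norm// (le_trans h1)// mulrC ler_wpM2r ?divr_ge0 ?(ltW d0)//.
  by rewrite gerBl ltW.
by rewrite ler_pM2l.
Qed.

End State.

(** * Elimination of the state from the payoffs *)

Section Payoff.
Context {R : realType}.
Set Implicit Arguments.
Unset Strict Implicit.
Local Notation mu := (@lebesgue_measure R).
Variables (G : game R) (eps : R).
Hypotheses (Gsust : sustainable G) (eps_ge0 : 0 <= eps).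
Implicit Types (v : 'I_3 -> R -> R) (y t : R) (z g : R -> R) (i : 'I_3).

Definition discount t : R := expR (- rho G * (t - eps)).

Lemma integrable_discount g B : measurable_fun `[eps, +oo[ g ->
  (forall t, eps <= t -> `|g t| <= B) ->
  mu.-integrable `[eps, +oo[ (EFin \o (fun t => discount t * g t)).
Proof.
move=> mg gB; have r0 := rho_gt0 G.
have ie : mu.-integrable `[eps, +oo[ (EFin \o discount).
  have i : mu.-integrable `[eps, +oo[ (EFin \o exponential_pdf (rho G)).
    by apply: integrableS (integrable_exponential_pdf r0).
  (* The factor turns the exponential density rho e^{-rho t} into [discount]. *)
  apply: eq_integrable (integrableZl _ (expR (rho G * eps) / rho G) i) => //= t.
  rewrite inE/= in_itv/= andbT => et; rewrite exponential_pdfE ?(le_trans eps_ge0)//.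
  rewrite -EFinM; congr (_%:E).
  rewrite mulrA divfK ?gt_eqF// -expRD /discount; congr expR; ring.
have := @integrableMl _ _ _ mu _ (measurable_itv _) (EFin \o discount) g ie mg.
have bg : [bounded g x | x in `[eps, +oo[].
  exists B; split; first by rewrite num_real.
  by move=> M /ltW BM t /=; rewrite in_itv/= andbT => /gB /le_trans; apply.
by move=> /(_ bg); apply: eq_integrable.
Qed.

Lemma discount_primitive : primitive_from 0 (fun t => - rho G * discount t) discount.
Proof.
move=> t t0; apply: (@increment_expR _ 0 1 (- rho G) eps) => // s _.
  by rewrite add0r mul1r.
by rewrite mul1r.
Qed.

Lemma discount_cvg0 : discount t @[t --> +oo] --> 0.
Proof.
have cy : rho G * (t - eps) @[t --> +oo] --> +oo.
  apply: gt0_cvgMry; first exact: rho_gt0.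
  by apply/cvgryPge => A; near=> t; rewrite lerBrDr; near: t; exact: nbhs_pinfty_ge.
have -> : discount = (fun t => expR (- (rho G * (t - eps)))).
  by apply/funext => t; rewrite -mulNr.
exact: cvg_comp _ _ cy (@cvgr_expR R).
Unshelve. all: by end_near. Qed.

Lemma L_measurable : measurable_fun `[eps, +oo[ (L G).
Proof. exact: primitive_from_measurable (primitive_from_ge eps_ge0 (L_primitive G)). Qed.

(* Integrand of the payoff of [i] after elimination of the state. *)
Definition gain i v t : R :=
  a G i * v i t * (b G i - v i t / 2) + q G i * L G t * inflow G v t.

Lemma inflow_normr v t : admissible G eps v -> eps <= t ->
  `|inflow G v t| <= inflow_max G.
Proof.
by move=> adm et; have /andP[f0 fM] := inflow_bounds adm et; rewrite ger0_norm.
Qed.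

Lemma integrable_discount_state y v z : admissible G eps v -> is_state G y eps v z ->
  mu.-integrable `[eps, +oo[ (EFin \o (fun t => discount t * z t)).
Proof.
move=> adm st; have [B _ zB] := state_bounded eps_ge0 adm st.
apply: (integrable_discount _ zB).
by have /is_stateP[pz _] := st; exact: primitive_from_measurable pz.
Qed.

Lemma integrable_discount_inflow v : admissible G eps v ->
  mu.-integrable `[eps, +oo[ (EFin \o (fun t => discount t * (L G t * inflow G v t))).
Proof.
move=> adm; have [B B0 LB] := L_bounded Gsust.
apply: (@integrable_discount _ (B * inflow_max G)).
  by apply: measurable_funM; [exact: L_measurable|exact: measurable_inflow].
move=> t et; rewrite normrM ler_pM// ?LB ?inflow_normr//.
exact: le_trans et.
Qed.

(** The product [discount] L z equals L(eps) y at eps and vanishes at infinity, since L and z are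
    bounded; its increment is thus - L(eps) y. *)
Lemma Rintegral_discount_state y v z : admissible G eps v -> is_state G y eps v z ->
  \int[mu]_(t in `[eps, +oo[) (discount t * z t) =
  - L G eps * y - \int[mu]_(t in `[eps, +oo[) (discount t * (L G t * inflow G v t)).
Proof.
move=> adm st.
have iz := integrable_discount_state adm st.
have il := integrable_discount_inflow adm.
apply/eqP; rewrite eq_sym subr_eq eq_sym -RintegralD//; apply/eqP.
have [BL BL0 LB] := L_bounded Gsust.
have [Bz Bz0 zB] := state_bounded eps_ge0 adm st.
have /is_stateP[pz zy] := st.
pose F t := discount t * L G t * z t.
have pF : primitive_from eps
    (fun t => discount t * z t + discount t * (L G t * inflow G v t)) F.
  have pJ := primitive_fromM discount_primitive (L_primitive G).
  have := primitive_fromM (primitive_from_ge eps_ge0 pJ) pz.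
  apply: eq_primitive_from => // t _.
  by rewrite /velocity -/(inflow G v t); ring.
rewrite (Rintegral_primitive_from _ pF (l := 0)).
- by rewrite /F zy /discount subrr mulr0 expR0 mul1r sub0r mulNr.
- by apply: eq_integrable (integrableD _ iz il).
- have c0 : discount t * (BL * Bz) @[t --> +oo] --> 0.
    rewrite -[X in _ --> X](mul0r (BL * Bz)).
    by apply: cvgM; [exact: discount_cvg0|exact: cvg_cst].
  apply: (@squeeze_cvgr _ _ _ _ (fun t => - (discount t * (BL * Bz)))
    (fun t => discount t * (BL * Bz))) => //.
    near=> t; rewrite -ler_norml /F !normrM -mulrA ler_pM//.
      by rewrite ger0_norm// expR_ge0.
    have et : eps <= t by near: t; apply: nbhs_pinfty_ge; rewrite num_real.
    by rewrite ler_pM// ?LB ?zB// (le_trans eps_ge0).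
  by rewrite -[X in _ --> X]oppr0; exact: cvgN.
Unshelve. all: by end_near. Qed.

Lemma integrable_gain i v : admissible G eps v ->
  mu.-integrable `[eps, +oo[ (EFin \o (fun t => discount t * gain i v t)).
Proof.
move=> adm; have [B B0 LB] := L_bounded Gsust; have [mv bv] := adm i.
have a0 := a_gt0 G i; have b0 := b_gt0 G i.
(* The first summand comes from 0 <= v_i <= b_i, the second from |L| <= B and the largest inflow. *)
apply: (@integrable_discount _ (a G i * b G i * b G i + `|q G i| * B * inflow_max G)).
  apply: measurable_funD; apply: measurable_funM.
  - exact: measurable_funM.
  - by apply: measurable_funB => //; exact: measurable_funM.
  - by apply: measurable_funM => //; exact: L_measurable.
  - exact: measurable_inflow.
move=> t et; have /andP[v0 vb] := bv t et.
rewrite (le_trans (ler_normD _ _))// lerD//; last first.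
  by rewrite !normrM !ler_pM// ?LB ?inflow_normr ?mulr_ge0// (le_trans eps_ge0).
rewrite ger0_norm; last by rewrite !mulr_ge0// ?(ltW a0)//; lra.
by rewrite ler_pM//; [rewrite mulr_ge0// ltW|lra|rewrite ler_pM2l|lra].
Qed.

Lemma payoffE i y v : admissible G eps v ->
  payoff G i y eps v = q G i * L G eps * y +
    \int[mu]_(t in `[eps, +oo[) (discount t * gain i v t).
Proof.
move=> adm; have st := state_is_state eps_ge0 y adm.
have iz := integrable_discount_state adm st.
have il := integrable_discount_inflow adm.
have ig := integrable_gain i adm.
set z := state G y eps v in st iz *.
have qZ g : mu.-integrable `[eps, +oo[ (EFin \o g) ->
    mu.-integrable `[eps, +oo[ (EFin \o (fun t => q G i * g t)).
  by move=> ig'; apply: eq_integrable (integrableZl _ (q G i) ig').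
(* The term q_i L f is added and subtracted; the integral of the discounted state contains L f with
   the opposite sign, so both cancel and q_i L(eps) y remains. *)
transitivity (\int[mu]_(t in `[eps, +oo[) (discount t * gain i v t -
    (q G i * (discount t * (L G t * inflow G v t)) + q G i * (discount t * z t)))).
  by apply: eq_Rintegral => t _; rewrite /gain -/(discount t) -/z; ring.
rewrite RintegralB//; last first.
  by apply: eq_integrable (integrableD _ (qZ _ il) (qZ _ iz)).
rewrite RintegralD//; [|exact: qZ|exact: qZ].
by rewrite !RintegralZl// (Rintegral_discount_state adm st); ring.
Qed.

Lemma le_payoff i y v v' : admissible G eps v -> admissible G eps v' ->
  (forall t, eps <= t -> gain i v t <= gain i v' t) ->
  payoff G i y eps v <= payoff G i y eps v'.
Proof.
move=> adm adm' h; rewrite !payoffE// lerD2l.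
apply: le_Rintegral => //; [exact: integrable_gain|exact: integrable_gain|].
move=> t /=; rewrite in_itv/= andbT => et.
by rewrite ler_wpM2l ?expR_ge0 ?h.
Qed.

End Payoff.

(** * Values of single players *)

Section Extremum.
Context {R : realType}.
Set Implicit Arguments.
Unset Strict Implicit.
Implicit Types (A : set R) (x : R).

(** The witness x keeps [xget] from falling back on its default, and antisymmetry makes it the only
    possible choice. *)
Lemma maximum_eq A x : A x -> ubound A x -> maximum A = x.
Proof.
move=> Ax ubx.
have [Am ubm] : (A `&` ubound A) (maximum A) by apply: (xgetPex 0); exists x.
by apply/le_anti; rewrite ubx// ubm.
Qed.

Lemma minimum_eq A x : A x -> lbound A x -> minimum A = x.
Proof.
move=> Ax lbx.
have [Am lbm] : (A `&` lbound A) (minimum A) by apply: (xgetPex 0); exists x.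
by apply/le_anti; rewrite lbx// lbm.
Qed.

End Extremum.

Lemma player_cases (i : 'I_3) : i = player1 \/ i = player2 \/ i = player3.
Proof.
by case: i => -[|[|[|//]]] h; [left|right; left|right; right]; exact: val_inj.
Qed.

(** * Upper bound for the value of a single player *)

Section Characteristic.
Context {R : realType}.
Set Implicit Arguments.
Unset Strict Implicit.
Variables (G : game R) (eps : R).
Hypotheses (Gsust : sustainable G) (eps_ge0 : 0 <= eps).
Implicit Types (v u w : 'I_3 -> R -> R) (y t : R) (i j : 'I_3) (pi : coalition_structure).

Definition full_emission : 'I_3 -> R -> R := fun j _ => b G j.

Lemma admissible_full_emission : admissible G eps full_emission.
Proof.
move=> j; split=> [|t _]; first exact: measurable_cst.
by rewrite lexx ltW// b_gt0.
Qed.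

(** Multiplied by xi_i / a_i, the two bounds of the standing assumption become -b_i and 0, so the
    control lies between 0 and b_i. *)
Lemma admissible_profile pi : admissible G eps (profile G pi).
Proof.
move=> j; split.
  apply: measurable_funD; first exact: measurable_cst.
  by apply: measurable_funM; [exact: measurable_cst|exact: L_measurable].
move=> t et; have /andP[cl cu] := sustainable_ge0 Gsust pi j (le_trans eps_ge0 et).
have a0 := a_gt0 G j; have x0 := xi_gt0 G j.
rewrite /profile -mulrA; apply/andP; split; last first.
  by rewrite gerDl mulr_ge0_le0// divr_ge0// ltW.
rewrite -lerBlDl sub0r -[- b G j]mulr1.
have -> : - b G j * 1 = xi G j / a G j * - (a G j * b G j / xi G j).
  by field; rewrite !gt_eqF.
by rewrite ler_wpM2l// divr_ge0// ltW.
Qed.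

Lemma admissible_join S u w : admissible G eps u -> admissible G eps w ->
  admissible G eps (join_profile S u w).
Proof.
by move=> au aw j; rewrite /join_profile; case: ifP => _; [exact: au|exact: aw].
Qed.

Lemma q_ge0 i : 0 <= q G i.
Proof.
have [->|[->|->]] := player_cases i.
- exact/ltW/q1_gt0.
- exact/ltW/q2_gt0.
- by rewrite q3_eq0.
Qed.

(** With the own control fixed, the gain varies with the inflow only through q_i L f, and q_i L <=
    0. *)
Lemma le_gain_inflow i v v' t : 0 <= t -> v i t = v' i t ->
  inflow G v' t <= inflow G v t -> gain G i v t <= gain G i v' t.
Proof.
move=> t0 vv' le; rewrite /gain vv' lerD2l ler_wnM2l//.
by rewrite mulr_ge0_le0 ?q_ge0// L_le0.
Qed.

Lemma le_inflow v v' t : (forall j, v j t <= v' j t) -> inflow G v t <= inflow G v' t.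
Proof. by move=> h; apply: ler_sum => j _; rewrite ler_pM2l ?xi_gt0. Qed.

Lemma inflow_join1 i u w t : inflow G (join_profile [set i]%SET u w) t =
  xi G i * u i t + \sum_(j < 3 | j != i) xi G j * w j t.
Proof.
rewrite /inflow (bigD1 i)//= /join_profile finset.in_set1 eqxx; congr (_ + _).
by apply: eq_bigr => j ji; rewrite finset.in_set1 (negbTE ji).
Qed.

(* The gap is [a_i / 2] times the square of the deviation from [profile pi i]. *)
Lemma gain_profile_optimal pi i u w t : cost_weight G pi i = q G i ->
  gain G i (join_profile [set i]%SET u w) t <=
  gain G i (join_profile [set i]%SET (profile G pi) w) t.
Proof.
move=> cq; rewrite /gain !inflow_join1 /join_profile finset.in_set1 eqxx.
set r := \sum_(j < 3 | j != i) _.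
rewrite -subr_ge0; set p := profile G pi i t.
have a0 := a_gt0 G i.
rewrite [X in 0 <= X](_ : _ = a G i / 2 * (u i t - p) ^+ 2).
  by rewrite mulr_ge0 ?sqr_ge0// divr_ge0// ltW.
(* The formula for p, solved for q_i L, makes the gap a polynomial in u_i and p. *)
have -> : q G i * L G t = a G i / xi G i * (p - b G i).
  by rewrite /p /profile cq; field; rewrite !gt_eqF// xi_gt0.
by field; rewrite gt_eqF// xi_gt0.
Qed.

Lemma coalition_payoff1 i y v :
  coalition_payoff G [set i]%SET y eps v = payoff G i y eps v.
Proof. by rewrite /coalition_payoff big_set1. Qed.

(** The value is computed exactly, as the payoff of i playing [profile G pi] against
    [full_emission], and then compared with the payoff under the whole profile. *)
Lemma charfun1_le i pi y : cost_weight G pi i = q G i ->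
  charfun G y eps [set i]%SET <= payoff G i y eps (profile G pi).
Proof.
move=> cq.
have afull := admissible_full_emission; have apr := admissible_profile pi.
(* Full emission is the worst reply to every u, so the max-min becomes a plain maximum over u. *)
have minE u : admissible G eps u ->
    minimum [set coalition_payoff G [set i]%SET y eps (join_profile [set i]%SET u w)
            | w in admissible G eps] =
    payoff G i y eps (join_profile [set i]%SET u full_emission).
  move=> au; apply: minimum_eq.
    by exists full_emission => //; rewrite coalition_payoff1.
  move=> _ [w aw <-]; rewrite coalition_payoff1.
  apply: le_payoff => //; [exact: admissible_join|exact: admissible_join|].
  move=> t et; apply: le_gain_inflow; first exact: le_trans et.
    by rewrite /join_profile finset.in_set1 eqxx.
  apply: le_inflow => j; rewrite /join_profile; case: ifP => // _.
  by have [_ /(_ t et)/andP[]] := aw j.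
have i0 : ([set i]%SET == finset.set0) = false.
  by apply/negbTE/finset.set0Pn; exists i; rewrite finset.in_set1.
have iT : ([set i]%SET == [set: 'I_3]%SET) = false.
  apply/negbTE/eqP => /(congr1 (fun A : {set 'I_3} => #|A|)).
  by rewrite cards1 cardsT card_ord.
rewrite /charfun i0 iT (@maximum_eq _ _ (payoff G i y eps
  (join_profile [set i]%SET (profile G pi) full_emission))).
(* Passing from full emission to the profile controls of the opponents lowers the inflow. *)
- apply: le_payoff => //; first exact: admissible_join.
  move=> t et; apply: le_gain_inflow; first exact: le_trans et.
    by rewrite /join_profile finset.in_set1 eqxx.
  apply: le_inflow => j; rewrite /join_profile; case: ifP => // _.
  by have [_ /(_ t et)/andP[]] := apr j.
- by exists (profile G pi) => //; rewrite minE.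
- move=> _ [u au <-]; rewrite (minE _ au).
  apply: le_payoff => //; [exact: admissible_join|exact: admissible_join|].
  by move=> t et; exact: gain_profile_optimal.
Qed.

End Characteristic.

Theorem lemma1 (R : realType) (G : game R) (Gsust : sustainable G)
    (eps : R) (eps_ge0 : 0 <= eps) :
  sustainably_cooperative G eps `<=` imputations G eps.
Proof.
move=> zeta [sum_zeta zeta1 zeta2 zeta3]; split=> // i.
have [->|[->|->]] := player_cases i.
(* The structure bounding each player in Z gives that player the weight q_i: q_1 in [pi42], q_2 in
   [pi41], and 0 = q_3 in [pi3]. *)
- exact: le_trans (charfun1_le Gsust eps_ge0 _ _) zeta1.
- exact: le_trans (charfun1_le Gsust eps_ge0 _ _) zeta2.
- apply: le_trans (charfun1_le Gsust eps_ge0 _ _) zeta3.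
  by rewrite q3_eq0.
Qed.
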